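(* Let $\mathcal{H}$ be a real Hilbert space, let $A\colon \mathcal{H}\rightrightarrows\mathcal{H}$ be maximally monotone, let $B\colon \mathcal{H}\to\mathcal{H}$ be monotone and $L$-Lipschitz continuous, and suppose that $(A+B)^{-1}(0)\neq\varnothing$. Suppose $(\lambda_k)_{k\geq -1}\subseteq\left[\varepsilon,\frac{1-2\varepsilon}{2L}\right]$ for some $\varepsilon>0$. Given $x_0,x_{-1}\in\mathcal{H}$, define the sequence $(x_k)$ by $$x_{k+1} = J_{\lambda_k A}\bigl(x_k - \lambda_k B(x_k) - \lambda_{k-1}(B(x_k)-B(x_{k-1})) \bigr) \quad\forall k\in\mathbb{N}=\{0,1,2,\dots\}.$$ Then $(x_k)$ converges weakly to a point contained in $(A+B)^{-1}(0)=\{x\in\mathcal{H}: 0\in A(x)+B(x)\}$.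
   Context: For a maximally monotone operator $A$ and $\lambda>0$, the resolvent is $J_{\lambda A}:=(I+\lambda A)^{-1}$, which is single-valued and defined everywhere on $\mathcal{H}$. An operator $B$ is monotone if $\langle x-y,B(x)-B(y)\rangle\geq 0$ for all $x,y$, and $L$-Lipschitz if $\|B(x)-B(y)\|\leq L\|x-y\|$ for all $x,y$. *)

(* Defs.v *)
From Stdlib Require Import Reals.
Open Scope R_scope.

Record HilbertSpace := {
  hcar :> Type;
  hzero : hcar;
  hadd : hcar -> hcar -> hcar;
  hopp : hcar -> hcar;
  hscal : R -> hcar -> hcar;
  hinner : hcar -> hcar -> R;
  haddA : forall x y z, hadd x (hadd y z) = hadd (hadd x y) z;
  haddC : forall x y, hadd x y = hadd y x;
  hadd0 : forall x, hadd hzero x = x;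
  haddN : forall x, hadd x (hopp x) = hzero;
  hscalA : forall a b x, hscal a (hscal b x) = hscal (a * b) x;
  hscal1 : forall x, hscal 1 x = x;
  hscalDr : forall a x y, hscal a (hadd x y) = hadd (hscal a x) (hscal a y);
  hscalDl : forall a b x, hscal (a + b) x = hadd (hscal a x) (hscal b x);
  hinnerC : forall x y, hinner x y = hinner y x;
  hinnerDl : forall x y z, hinner (hadd x y) z = hinner x z + hinner y z;
  hinnerZl : forall a x y, hinner (hscal a x) y = a * hinner x y;
  hinner_ge0 : forall x, 0 <= hinner x x;
  hinner_eq0 : forall x, hinner x x = 0 -> x = hzero;
  hcomplete : forall u : nat -> hcar,
    (forall eps, 0 < eps -> exists N, forall m n, (N <= m)%nat -> (N <= n)%nat ->
        sqrt (hinner (hadd (u m) (hopp (u n))) (hadd (u m) (hopp (u n)))) < eps) ->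
    exists l, Un_cv (fun n => sqrt (hinner (hadd (u n) (hopp l)) (hadd (u n) (hopp l)))) 0
}.

Arguments hzero {h}.
Arguments hadd {h}.
Arguments hopp {h}.
Arguments hscal {h}.
Arguments hinner {h}.

Definition hsub {H : HilbertSpace} (x y : H) : H := hadd x (hopp y).
Definition hnorm {H : HilbertSpace} (x : H) : R := sqrt (hinner x x).

(* Set-valued operators H ⇉ H, given by their graph: [A x u] means u ∈ A(x). *)
Definition setop (H : HilbertSpace) := H -> H -> Prop.

Definition monotone_op {H : HilbertSpace} (A : setop H) : Prop :=
  forall x y u v, A x u -> A y v -> 0 <= hinner (hsub x y) (hsub u v).

Definition maximally_monotone {H : HilbertSpace} (A : setop H) : Prop :=
  monotone_op A /\
  forall A' : setop H, monotone_op A' -> (forall x u, A x u -> A' x u) ->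
    forall x u, A' x u -> A x u.

Definition monotone_fun {H : HilbertSpace} (B : H -> H) : Prop :=
  forall x y, 0 <= hinner (hsub x y) (hsub (B x) (B y)).

Definition lipschitz {H : HilbertSpace} (L : R) (B : H -> H) : Prop :=
  forall x y, hnorm (hsub (B x) (B y)) <= L * hnorm (hsub x y).

(* Graph of the resolvent J_{lam A} = (I + lam A)^{-1}:
   [resolvent_graph A lam z p] means p ∈ (I + lam A)^{-1}(z), i.e. z ∈ p + lam A(p).
   (For A maximally monotone and lam > 0 this relation is a total function.) *)
Definition resolvent_graph {H : HilbertSpace} (A : setop H) (lam : R) (z p : H) : Prop :=
  exists a, A p a /\ z = hadd p (hscal lam a).

Definition zero_of_sum {H : HilbertSpace} (A : setop H) (B : H -> H) (x : H) : Prop :=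
  exists a, A x a /\ hadd a (B x) = hzero.

Definition weakly_converges {H : HilbertSpace} (u : nat -> H) (l : H) : Prop :=
  forall y : H, Un_cv (fun n => hinner (u n) y) (hinner l y).

(* Main.v *)
(* For a zero z of A + B, monotonicity of A at (x_(k+1), z) and Young's inequality give
   the Lyapunov function
     energy_k(z) = |x_k - z|^2 + 2 lam_(k-1) <x_k - z, B x_(k-1) - B x_k> + |x_k - x_(k-1)|^2 / 2,
   which decreases by at least eps |x_(k+1) - x_k|^2 at each step and dominates
   |x_k - z|^2 / 2. Hence |x_(k+1) - x_k| -> 0, |x_k - z| converges, and x_(k+1) lies in the
   domain of A with a residual in (A + B)(x_(k+1)) tending to 0. Weak cluster points, taken
   along free ultrafilters on nat since H need not be separable, are therefore zeros of
   A + B, and Opial's argument shows that there is only one. *)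
Require Import Defs.
From Stdlib Require Import Reals Lra Lia Classical ClassicalEpsilon.
From mathcomp.classical Require filter.
Open Scope R_scope.

(** * Bilinearity of the inner product and its normalisation *)

Section InnerProduct.
Context {H : HilbertSpace}.
Implicit Types x y z : H.

Lemma inner0l y : hinner hzero y = 0.
Proof.
  pose proof (hinnerDl H hzero hzero y) as E. rewrite hadd0 in E. lra.
Qed.

Lemma innerNl x y : hinner (hopp x) y = - hinner x y.
Proof.
  pose proof (hinnerDl H x (hopp x) y) as E.
  rewrite haddN, inner0l in E. lra.
Qed.

Lemma inner0r y : hinner y hzero = 0.
Proof. now rewrite hinnerC, inner0l. Qed.

Lemma innerNr x y : hinner x (hopp y) = - hinner x y.
Proof. now rewrite hinnerC, innerNl, hinnerC. Qed.

Lemma innerDr x y z : hinner x (hadd y z) = hinner x y + hinner x z.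
Proof. now rewrite hinnerC, hinnerDl, (hinnerC _ y), (hinnerC _ z). Qed.

Lemma innerZr a x y : hinner x (hscal a y) = a * hinner x y.
Proof. now rewrite hinnerC, hinnerZl, hinnerC. Qed.

End InnerProduct.

(* Writes every inner product in terms of those of the atoms; the loop below orients
   symmetric pairs the same way, so that [lra] sees them as equal. *)
Ltac inner_expand :=
  unfold hsub in *;
  repeat (rewrite ?hinnerDl, ?innerDr, ?innerNl, ?innerNr, ?hinnerZl, ?innerZr,
    ?inner0l, ?inner0r in * );
  repeat match goal with
  | |- context [@hinner ?H ?a ?b] =>
    match goal with
    | |- context [@hinner H b a] =>
      assert_fails (constr_eq a b); rewrite (hinnerC H b a) in *
    | E : context [@hinner H b a] |- _ =>
      assert_fails (constr_eq a b); rewrite (hinnerC H b a) in *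
    end
  | E : context [@hinner ?H ?a ?b] |- _ =>
    match goal with
    | F : context [@hinner H b a] |- _ =>
      assert_fails (constr_eq a b); rewrite (hinnerC H b a) in *
    end
  end.

(** * Inequalities in Hilbert space and Riesz representation *)

Section HilbertGeometry.
Context {H : HilbertSpace}.
Implicit Types x y z p q : H.

Lemma inner_ext x y : (forall z, hinner x z = hinner y z) -> x = y.
Proof.
  intros E.
  assert (E0 : hadd x (hopp y) = hzero).
  { apply hinner_eq0. rewrite hinnerDl, innerNl, E. lra. }
  rewrite <- (hadd0 H y), <- E0, <- haddA, (haddC H (hopp y)), haddN, haddC.
  now rewrite hadd0.
Qed.

Lemma inner_young x y : 2 * hinner x y <= hinner x x + hinner y y.
Proof.
  pose proof (hinner_ge0 H (hsub x y)). inner_expand. lra.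
Qed.

Lemma inner_young_neg x y : - (2 * hinner x y) <= hinner x x + hinner y y.
Proof.
  pose proof (hinner_ge0 H (hadd x y)). inner_expand. lra.
Qed.

Lemma cauchy_schwarz x y :
  hinner x y * hinner x y <= hinner x x * hinner y y.
Proof.
  pose proof (hinner_ge0 H x) as Hx. pose proof (hinner_ge0 H y) as Hy.
  destruct (Req_dec (hinner y y) 0) as [E|E].
  - apply hinner_eq0 in E. subst. rewrite inner0r, inner0l. lra.
  (* This square equals |y|^2 (|x|^2 |y|^2 - <x, y>^2), and |y|^2 > 0. *)
  - pose proof (hinner_ge0 H
      (hsub (hscal (hinner y y) x) (hscal (hinner x y) y))) as P.
    inner_expand. nra.
Qed.

Lemma inner_sub_sq_le x y :
  hinner (hsub x y) (hsub x y) <= 2 * (hinner x x + hinner y y).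
Proof.
  pose proof (inner_young_neg x y). inner_expand. lra.
Qed.

Lemma inner_add_sq_le x y :
  hinner (hadd x y) (hadd x y) <= 2 * (hinner x x + hinner y y).
Proof.
  pose proof (inner_young x y). inner_expand. lra.
Qed.

Lemma hnorm_sq x : hnorm x * hnorm x = hinner x x.
Proof. apply sqrt_sqrt, hinner_ge0. Qed.

Lemma hnorm_ge0 x : 0 <= hnorm x.
Proof. apply sqrt_pos. Qed.

(* Minimise |y|^2 - 2 f(y): minimising sequences are Cauchy by the parallelogram
   identity, and the limit represents [f]. *)
Lemma riesz (f : H -> R) (M : R) :
  (forall x y, f (hadd x y) = f x + f y) ->
  (forall a x, f (hscal a x) = a * f x) ->
  (forall y, 2 * f y <= M + hinner y y) ->
  exists p, forall y, f y = hinner p y.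
Proof.
  intros fD fZ fM.
  set (J := fun y => hinner y y - 2 * f y).
  (* [- m] is the infimum of [J], finite because [fM] gives J >= - M. *)
  destruct (completeness (fun t => exists y, t = - J y)) as [m [m_ub m_lub]].
  { exists M. intros t [y ->]. unfold J. specialize (fM y). lra. }
  { exists (- J hzero). now exists hzero. }
  assert (Jge : forall y, - m <= J y).
  { intros y. assert (- J y <= m) by (apply m_ub; now exists y). lra. }
  assert (near : forall n : nat, exists y, J y < - m + / (INR n + 1)).
  { intros n. pose proof (pos_INR n).
    assert (0 < / (INR n + 1)) by (apply Rinv_0_lt_compat; lra).
    apply NNPP. intros no.
    assert (m <= m - / (INR n + 1)); [|lra].
    apply m_lub. intros t [y ->].
    destruct (Rle_dec (- J y) (m - / (INR n + 1))) as [|no']; [easy|].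
    exfalso. apply no. exists y. lra. }
  set (u := fun n => proj1_sig (constructive_indefinite_description _ (near n))).
  assert (Hu : forall n, J (u n) < - m + / (INR n + 1)).
  { intros n. unfold u. apply proj2_sig. }
  clearbody u.
  assert (inv_small : forall e, 0 < e -> exists N, forall n, (N <= n)%nat ->
    0 < / (INR n + 1) < e).
  { intros e e0. destruct (archimed_cor1 e e0) as [N [HN N0]].
    exists N. intros n Nn. apply le_INR in Nn. apply lt_0_INR in N0.
    split; [apply Rinv_0_lt_compat; lra|].
    apply Rle_lt_trans with (/ INR N); [|easy].
    apply Rinv_le_contravar; lra. }
  destruct (hcomplete H u) as [p Hp].
  (* |u i - u j|^2 = 2 J(u i) + 2 J(u j) - 4 J(midpoint) is less than 4 times the tolerance. *)
  { intros e e0. destruct (inv_small (e * e / 4)) as [N HN]; [nra|].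
    exists N. intros i j Ni Nj.
    assert (hinner (hsub (u i) (u j)) (hsub (u i) (u j)) < e * e) as lt.
    { pose proof (Jge (hscal (1/2) (hadd (u i) (u j)))) as Jm.
      pose proof (Hu i) as Ji. pose proof (Hu j) as Jj.
      pose proof (HN i Ni). pose proof (HN j Nj).
      unfold J in Jm, Ji, Jj. rewrite fZ, fD in Jm. clear - H0 H1 Jm Ji Jj.
      inner_expand. lra. }
    fold (hsub (u i) (u j)). rewrite <- (sqrt_square e) by lra.
    apply sqrt_lt_1; [apply hinner_ge0|nra|exact lt]. }
  exists p. intros v.
  assert (Hd : 0 <= (hinner p v - f v) * (hinner p v - f v)) by apply Rle_0_sqr.
  destruct Hd as [Hd|Hd].
  2: { symmetry in Hd. apply Rmult_integral in Hd. lra. }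
  exfalso.
  set (d := (hinner p v - f v) * (hinner p v - f v)) in *.
  set (V := hinner v v + 1).
  assert (V1 : 1 <= V) by (unfold V; pose proof (hinner_ge0 H v); lra).
  (* The two error terms below are at most 2 V e and less than 2 V e, so d < 4 V e = d. Taking V >
     |v|^2 covers v = 0 too. *)
  set (e := d / (4 * V)).
  assert (e0 : 0 < e) by (apply Rdiv_lt_0_compat; lra).
  destruct (inv_small e e0) as [N1 HN1].
  destruct (Hp (sqrt e)) as [N2 HN2]; [now apply sqrt_lt_R0|].
  pose (n := Nat.max N1 N2).
  specialize (HN1 n (Nat.le_max_l _ _)). specialize (HN2 n (Nat.le_max_r _ _)).
  fold (hsub (u n) p) in HN2. unfold R_dist in HN2. rewrite Rminus_0_r in HN2.
  rewrite Rabs_pos_eq in HN2 by apply sqrt_pos.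
  apply sqrt_lt_0_alt in HN2.
  pose proof (cauchy_schwarz (hsub (u n) p) v) as CS.
  assert (g2 : (hinner (u n) v - f v) * (hinner (u n) v - f v) <= V * e).
  { set (g := hinner (u n) v - f v).
    (* Moving from [u n] by - g / V along [v] lowers J by at least g^2 / V, but J (u n) is within e
       of the infimum. *)
    pose proof (Jge (hadd (u n) (hscal (- g / V) v))) as Jt.
    pose proof (Hu n) as Jn. unfold J in Jt, Jn. rewrite fD, fZ in Jt.
    assert (Jt' : - e < (g / V) * (g / V) * (V - 1) - 2 * (g / V) * g).
    { unfold V at 3, g at 4. replace (- g / V) with (- (g / V)) in Jt by (unfold Rdiv; ring).
      generalize dependent (g / V). intros t. intros. clear - Jt Jn HN1.
      inner_expand. nra. }
    assert (tg : (g / V) * V = g) by (field; lra).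
    generalize dependent (g / V). intros t. intros.
    nra. }
  assert (d <= 2 * ((hinner (u n) v - f v) * (hinner (u n) v - f v))
    + 2 * (hinner (hsub (u n) p) v * hinner (hsub (u n) p) v)).
  { unfold d. clear. inner_expand.
    pose proof (Rle_0_sqr ((hinner (u n) v - f v) + (hinner (u n) v - hinner p v))) as S.
    unfold Rsqr in S. nra. }
  assert (Vd : 4 * V * e = d) by (unfold e; field; lra).
  assert (hinner (hsub (u n) p) (hsub (u n) p) * hinner v v < e * V).
  { unfold V. pose proof (hinner_ge0 H v).
    pose proof (hinner_ge0 H (hsub (u n) p)). nra. }
  lra.
Qed.

End HilbertGeometry.

(** * Free ultrafilters on nat and limits along them *)

Record free_ultrafilter (U : (nat -> Prop) -> Prop) : Prop := {
  fu_ex : forall P, U P -> exists k, P k;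
  fu_and : forall P Q, U P -> U Q -> U (fun k => P k /\ Q k);
  fu_mono : forall P Q : nat -> Prop, (forall k, P k -> Q k) -> U P -> U Q;
  fu_dec : forall P, U P \/ U (fun k => ~ P k);
  fu_tail : forall N, U (fun k => (N <= k)%nat)
}.

(** The intersections of [S] with the tails generate a proper filter, as none is empty; any
    ultrafilter above it contains [S] and all tails. *)
Lemma free_ultrafilter_of_frequent (S : nat -> Prop) :
  (forall N, exists n, (N <= n)%nat /\ S n) ->
  exists U, free_ultrafilter U /\ U S.
Proof.
  intros inf.
  set (F := fun P : nat -> Prop =>
    exists N, forall n, (N <= n)%nat -> S n -> P n).
  assert (PF : filter.ProperFilter F).
  { constructor.
    - intros [N HN]. destruct (inf N) as [n [Nn Sn]]. exact (HN n Nn Sn).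
    - constructor.
      + now exists O.
      + intros P Q [N HN] [N' HN']. exists (Nat.max N N').
        intros n Hn Sn. split; [apply HN|apply HN']; auto; lia.
      + intros P Q PQ [N HN]. exists N. intros n Hn Sn. apply PQ, HN; auto. }
  destruct (filter.ultraFilterLemma PF) as [U [UU FU]].
  exists U. pose proof (filter.ultra_proper (F := U)) as [U0 [UT UI US]].
  split; [|apply FU; now exists O].
  constructor.
  - intros P UP. apply NNPP. intros no. apply U0.
    refine (US P _ _ UP). intros k Pk. apply no. now exists k.
  - intros P Q UP UQ. exact (UI P Q UP UQ).
  - intros P Q PQ UP. exact (US P Q PQ UP).
  - intros P. exact (filter.in_ultra_setVsetC P UU).
  - intros N. apply FU. exists N. auto.
Qed.

Definition ulim (U : (nat -> Prop) -> Prop) (u : nat -> R) (l : R) : Prop :=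
  forall e, 0 < e -> U (fun k => Rabs (u k - l) < e).

Section UltraLimit.
Context (U : (nat -> Prop) -> Prop) (HU : free_ultrafilter U).
Implicit Types u v : nat -> R.

Lemma ulim_le u v l m :
  (forall k, u k <= v k) -> ulim U u l -> ulim U v m -> l <= m.
Proof.
  intros le Hu Hv. apply Rnot_lt_le. intros lt.
  pose proof (fu_and _ HU _ _ (Hu ((l - m) / 2) ltac:(lra))
    (Hv ((l - m) / 2) ltac:(lra))) as W.
  destruct (fu_ex _ HU _ W) as [k [A1 A2]].
  apply Rabs_def2 in A1. apply Rabs_def2 in A2. specialize (le k). lra.
Qed.

Lemma ulim_unique u l m : ulim U u l -> ulim U u m -> l = m.
Proof.
  intros Hl Hm. apply Rle_antisym; eapply ulim_le; eauto; intros; apply Rle_refl.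
Qed.

Lemma ulim_cv u l : Un_cv u l -> ulim U u l.
Proof.
  intros cv e e0. destruct (cv e e0) as [N HN].
  exact (fu_mono _ HU _ _ HN (fu_tail _ HU N)).
Qed.

Lemma ulim_const c : ulim U (fun _ => c) c.
Proof.
  apply ulim_cv. intros e e0. exists O. intros. now rewrite R_dist_eq.
Qed.

Lemma ulim_ext u v l : (forall k, u k = v k) -> ulim U u l -> ulim U v l.
Proof.
  intros uv Hu e e0. refine (fu_mono _ HU _ _ _ (Hu e e0)).
  intros k. now rewrite uv.
Qed.

Lemma ulim_add u v l m :
  ulim U u l -> ulim U v m -> ulim U (fun k => u k + v k) (l + m).
Proof.
  intros Hu Hv e e0.
  refine (fu_mono _ HU _ _ _
    (fu_and _ HU _ _ (Hu (e / 2) ltac:(lra)) (Hv (e / 2) ltac:(lra)))).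
  intros k [A1 A2]. apply Rabs_def2 in A1. apply Rabs_def2 in A2.
  apply Rabs_def1; lra.
Qed.

Lemma ulim_scal a u l : ulim U u l -> ulim U (fun k => a * u k) (a * l).
Proof.
  intros Hu e e0. pose proof (Rabs_pos a) as a0.
  refine (fu_mono _ HU _ _ _ (Hu (e / (Rabs a + 1)) _)).
  - intros k A1. rewrite <- Rmult_minus_distr_l, Rabs_mult.
    pose proof (Rabs_pos (u k - l)).
    apply Rmult_lt_compat_r with (r := Rabs a + 1) in A1; [|lra].
    unfold Rdiv in A1. rewrite Rmult_assoc, Rinv_l in A1 by lra. nra.
  - apply Rdiv_lt_0_compat; lra.
Qed.

Lemma ulim_sub u v l m :
  ulim U u l -> ulim U v m -> ulim U (fun k => u k - v k) (l - m).
Proof.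
  intros Hu Hv. apply ulim_scal with (a := -1) in Hv.
  replace (l - m) with (l + -1 * m) by ring.
  eapply ulim_ext; [|exact (ulim_add _ _ _ _ Hu Hv)]. intros; simpl; ring.
Qed.

(** The limit is the supremum of the t with t <= u k for [U]-many k; just above it, [fu_dec] selects
    the complementary set. *)
Lemma ulim_exists u M : (forall k, Rabs (u k) <= M) -> exists l, ulim U u l.
Proof.
  intros bd.
  assert (bd' : forall k, - M <= u k <= M).
  { intros k. specialize (bd k). pose proof (Rle_abs (u k)).
    pose proof (Rle_abs (- u k)) as N. rewrite Rabs_Ropp in N. lra. }
  destruct (completeness (fun t => U (fun k => t <= u k))) as [l [ub lub]].
  - exists M. intros t Ut. destruct (fu_ex _ HU _ Ut) as [k Hk].
    specialize (bd' k). lra.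
  - exists (- M). refine (fu_mono _ HU _ _ _ (fu_tail _ HU O)).
    intros k _. apply bd'.
  - exists l. intros e e0.
    assert (lo : exists t, l - e < t /\ U (fun k => t <= u k)).
    { apply NNPP. intros no. assert (l <= l - e); [|lra].
      apply lub. intros t Ut. apply Rnot_lt_le. intros lt. apply no. now exists t. }
    destruct lo as [t [lt Ut]].
    assert (hi : U (fun k => ~ (l + e / 2 <= u k))).
    { destruct (fu_dec _ HU (fun k => l + e / 2 <= u k)) as [B|]; [|easy].
      apply ub in B. lra. }
    refine (fu_mono _ HU _ _ _ (fu_and _ HU _ _ Ut hi)).
    intros k [A1 A2]. apply Rabs_def1; lra.
Qed.

(** Stands in for weak compactness of balls: the limits of <u k, y> are linear in y, and Young's
    inequality gives the bound that [riesz] asks for. *)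
Lemma weak_ulim_exists (H : HilbertSpace) (u : nat -> H) M :
  (forall k, hinner (u k) (u k) <= M) ->
  exists p, forall y, ulim U (fun k => hinner (u k) y) (hinner p y).
Proof.
  intros bd.
  assert (ex : forall y, exists l, ulim U (fun k => hinner (u k) y) l).
  { intros y. apply ulim_exists with (M := M + hinner y y). intros k.
    pose proof (inner_young (u k) y). pose proof (inner_young_neg (u k) y).
    pose proof (hinner_ge0 H (u k)). pose proof (hinner_ge0 H y).
    specialize (bd k). apply Rabs_le. lra. }
  set (f := fun y => proj1_sig (constructive_indefinite_description _ (ex y))).
  assert (Hf : forall y, ulim U (fun k => hinner (u k) y) (f y)).
  { intros y. unfold f. apply proj2_sig. }
  clearbody f.
  destruct (riesz f M) as [p Hp].
  - intros x y. apply (ulim_unique _ _ _ (Hf (hadd x y))).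
    eapply ulim_ext; [|exact (ulim_add _ _ _ _ (Hf x) (Hf y))].
    intros k. symmetry. apply innerDr.
  - intros a x. apply (ulim_unique _ _ _ (Hf (hscal a x))).
    eapply ulim_ext; [|exact (ulim_scal a _ _ (Hf x))].
    intros k. symmetry. apply innerZr.
  - intros y. refine (ulim_le _ _ _ _ _ (ulim_scal 2 _ _ (Hf y))
      (ulim_const (M + hinner y y))).
    intros k. simpl. pose proof (inner_young (u k) y). specialize (bd k). lra.
  - exists p. intros y. rewrite <- Hp. apply Hf.
Qed.

End UltraLimit.

(** * Ordinary limits of real sequences *)

Lemma Un_cv_ext u v l : (forall k, u k = v k) -> Un_cv u l -> Un_cv v l.
Proof.
  intros uv cv e e0. destruct (cv e e0) as [N HN]. exists N.
  intros n Hn. rewrite <- uv. now apply HN.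
Qed.

Lemma Un_cv_succ u l : Un_cv u l -> Un_cv (fun k => u (S k)) l.
Proof.
  intros cv e e0. destruct (cv e e0) as [N HN]. exists N.
  intros n Hn. apply HN. lia.
Qed.

Lemma Un_cv_of_succ u l : Un_cv (fun k => u (S k)) l -> Un_cv u l.
Proof.
  intros cv e e0. destruct (cv e e0) as [N HN]. exists (S N).
  intros [|n] Hn; [lia|]. apply HN. lia.
Qed.

Lemma Un_cv_const c : Un_cv (fun _ => c) c.
Proof. intros e e0. exists O. intros. now rewrite R_dist_eq. Qed.

Lemma Un_cv_squeeze0 u v :
  (forall k, 0 <= u k <= v k) -> Un_cv v 0 -> Un_cv u 0.
Proof.
  intros uv cv e e0. destruct (cv e e0) as [N HN]. exists N. intros n Hn.
  specialize (HN n Hn). specialize (uv n). unfold R_dist in *.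
  rewrite Rminus_0_r in *. rewrite Rabs_pos_eq in * by lra. lra.
Qed.

(** * Strong against weak limits, and Opial's lemma *)

Section WeakConvergence.
Context {H : HilbertSpace}.

(** Cauchy-Schwarz gives <u k, w k>^2 <= M |w k|^2. *)
Lemma inner_cv0 (u w : nat -> H) M :
  (forall k, hinner (u k) (u k) <= M) ->
  Un_cv (fun k => hinner (w k) (w k)) 0 ->
  Un_cv (fun k => hinner (u k) (w k)) 0.
Proof.
  intros bd cv e e0.
  assert (M0 : 0 <= M).
  { exact (Rle_trans _ _ _ (hinner_ge0 H (u O)) (bd O)). }
  destruct (cv (e * e / (M + 1))) as [N HN].
  { apply Rdiv_lt_0_compat; nra. }
  exists N. intros n Hn. specialize (HN n Hn).
  unfold R_dist in *. rewrite Rminus_0_r in *.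
  rewrite Rabs_pos_eq in HN by apply hinner_ge0.
  apply Rmult_lt_compat_r with (r := M + 1) in HN; [|lra].
  unfold Rdiv in HN. rewrite Rmult_assoc, Rinv_l in HN by lra.
  pose proof (cauchy_schwarz (u n) (w n)). specialize (bd n).
  pose proof (hinner_ge0 H (w n)). pose proof (hinner_ge0 H (u n)).
  rewrite <- (Rabs_pos_eq e) by lra. apply Rsqr_lt_abs_0. unfold Rsqr. nra.
Qed.

(* Two ultrafilter limits p, p' agree because <u k, p - p'> has an ordinary limit. *)
Lemma opial (Z : H -> Prop) (u : nat -> H) M :
  (forall k, hinner (u k) (u k) <= M) ->
  (forall z, Z z -> exists l, Un_cv (fun k => hinner (hsub (u k) z) (hsub (u k) z)) l) ->
  (forall U p, free_ultrafilter U ->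
     (forall y, ulim U (fun k => hinner (u k) y) (hinner p y)) -> Z p) ->
  exists p, Z p /\ weakly_converges u p.
Proof.
  intros bd cvZ clZ.
  destruct (free_ultrafilter_of_frequent (fun _ => True)) as [U [HU _]].
  { intros N. now exists N. }
  destruct (weak_ulim_exists U HU H u M bd) as [p Hp].
  assert (Zp := clZ U p HU Hp).
  exists p. split; [easy|]. intros y. apply NNPP. intros ncv.
  assert (bad : exists e, 0 < e /\ forall N, exists n, (N <= n)%nat /\
    e <= R_dist (hinner (u n) y) (hinner p y)).
  { apply NNPP. intros no. apply ncv. intros e e0. apply NNPP. intros no'.
    apply no. exists e. split; [easy|]. intros N. apply NNPP. intros no''.
    apply no'. exists N. intros n Hn. apply Rnot_le_lt. intros le.
    apply no''. now exists n. }
  destruct bad as [e [e0 bad]].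
  (* [V] lives on indices where <u n, y> stays e away from <p, y>, so its weak limit [q] cannot
     equal [p]. *)
  destruct (free_ultrafilter_of_frequent _ bad) as [V [HV badV]].
  destruct (weak_ulim_exists V HV H u M bd) as [q Hq].
  assert (Zq := clZ V q HV Hq).
  destruct (cvZ p Zp) as [lp Hlp]. destruct (cvZ q Zq) as [lq Hlq].
  (* From 2 <u, p - q> = |u - q|^2 - |u - p|^2 + |p|^2 - |q|^2. *)
  assert (cv : Un_cv (fun k => hinner (u k) (hsub p q))
    (1/2 * (lq - lp + (hinner p p - hinner q q)))).
  { apply Un_cv_ext with (fun k => 1/2 * ((hinner (hsub (u k) q) (hsub (u k) q)
      - hinner (hsub (u k) p) (hsub (u k) p)) + (hinner p p - hinner q q))).
    - intros k. clear. inner_expand. lra.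
    - apply CV_mult; [apply Un_cv_const|].
      apply CV_plus; [now apply CV_minus|apply Un_cv_const]. }
  assert (E : hinner p (hsub p q) = hinner q (hsub p q)).
  { rewrite (ulim_unique U HU _ _ _ (Hp (hsub p q)) (ulim_cv U HU _ _ cv)).
    exact (ulim_unique V HV _ _ _ (ulim_cv V HV _ _ cv) (Hq (hsub p q))). }
  assert (pq : hsub p q = hzero).
  { apply hinner_eq0. clear - E. inner_expand. lra. }
  assert (Ey : hinner p y = hinner q y).
  { assert (hinner (hsub p q) y = 0) as E0 by (rewrite pq; apply inner0l).
    clear - E0. inner_expand. lra. }
  destruct (fu_ex _ HV _ (fu_and _ HV _ _ badV (Hq y e e0))) as [k [A1 A2]].
  unfold R_dist in A1. rewrite Ey in A1. lra.
Qed.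

End WeakConvergence.

(** * Monotone operators and weak limits of approximate zeros *)

Section Operators.
Context {H : HilbertSpace} (A : setop H) (B : H -> H) (L : R).
Implicit Types x y z p q : H.

(** Adjoining (p, q) to the graph of [A] keeps it monotone. *)
Lemma maximally_monotone_mem p q :
  maximally_monotone A ->
  (forall y v, A y v -> 0 <= hinner (hsub p y) (hsub q v)) -> A p q.
Proof.
  intros [mono maxi] rel.
  apply (maxi (fun x v => A x v \/ (x = p /\ v = q))); [|auto|auto].
  intros x y v w [Axv|[-> ->]] [Ayw|[-> ->]]; auto.
  - specialize (rel x v Axv). clear - rel. inner_expand. lra.
  - clear. inner_expand. lra.
Qed.

Lemma lipschitz_sq : lipschitz L B -> forall x y,
  hinner (hsub (B x) (B y)) (hsub (B x) (B y)) <=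
  L * L * hinner (hsub x y) (hsub x y).
Proof.
  intros lip x y. specialize (lip x y). rewrite <- !hnorm_sq.
  pose proof (hnorm_ge0 (hsub (B x) (B y))). nra.
Qed.

Context (monoB : monotone_fun B) (lipB : lipschitz L B).

(** Minty's trick: with v = q - B p, testing at p + t v gives |v|^2 <= <v, B (p + t v) - B p>, which
    for small t forces v = 0. *)
Lemma monotone_lipschitz_mem p q :
  (forall y, 0 <= hinner (hsub p y) (hsub q (B y))) -> q = B p.
Proof.
  intros rel. set (v := hsub q (B p)).
  (* Then |L| t <= 1/2, so |B (p + t v) - B p| <= |v| / 2 and Young's inequality yields |v|^2 <= 5/8
     |v|^2. *)
  set (t := / (2 * (Rabs L + 1))).
  pose proof (Rabs_pos L) as L0.
  assert (tpos : 0 < t) by (apply Rinv_0_lt_compat; lra).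
  assert (Lt : L * L * (t * t) <= 1 / 4).
  { assert (Et : (Rabs L + 1) * t = 1 / 2) by (unfold t; field; lra).
    rewrite <- (Rabs_pos_eq (L * L)) by apply Rle_0_sqr. rewrite Rabs_mult. nra. }
  pose proof (rel (hadd p (hscal t v))) as R0.
  pose proof (lipschitz_sq lipB (hadd p (hscal t v)) p) as Lp.
  pose proof (inner_young v (hsub (B (hadd p (hscal t v))) (B p))) as Yg.
  pose proof (hinner_ge0 H v) as v0.
  generalize dependent (B (hadd p (hscal t v))). intros b Rb Lp Yg.
  assert (R1 : hinner v (hsub q b) <= 0).
  { assert (t * hinner v (hsub q b) <= 0); [|nra].
    clear - Rb. generalize dependent v. intros v Rb. inner_expand. lra. }
  assert (Lp' : hinner (hsub b (B p)) (hsub b (B p)) <= 1 / 4 * hinner v v).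
  { apply Rle_trans with (L * L * (t * t) * hinner v v); [|nra].
    replace (hinner (hsub (hadd p (hscal t v)) p) (hsub (hadd p (hscal t v)) p))
      with (t * t * hinner v v) in Lp; [lra|].
    clear. generalize v. intros w. inner_expand. lra. }
  assert (Ev : hinner v v = hinner v (hsub q b) + hinner v (hsub b (B p))).
  { unfold v at 2. clear. generalize v. intros w. inner_expand. lra. }
  assert (E0 : v = hzero) by (apply hinner_eq0; lra).
  apply inner_ext. intros z.
  assert (hinner v z = 0) as Ez by (rewrite E0; apply inner0l).
  unfold v in Ez. clear - Ez. inner_expand. lra.
Qed.

(* With q the weak limit of B (X k), c the limit of <X k, B (X k)> and
   d = c - <p, q>, passing to the limit in the two monotonicity inequalities gives
   <p - y, q - B y> + d >= 0 and <p - y, - q - v> >= d for all y and (y, v) in A.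
   The first one at y = p forces d >= 0, so (p, - q) is in A by maximality; the
   second one at (p, - q) then forces d = 0. This avoids the maximality of A + B. *)
Lemma zero_of_sum_weak_limit U (X a : nat -> H) M p :
  free_ultrafilter U -> maximally_monotone A ->
  (forall k, A (X k) (a k)) ->
  (forall k, hinner (X k) (X k) <= M) ->
  Un_cv (fun k => hinner (hadd (a k) (B (X k))) (hadd (a k) (B (X k)))) 0 ->
  (forall y, ulim U (fun k => hinner (X k) y) (hinner p y)) ->
  zero_of_sum A B p.
Proof.
  intros HU maxA HA bd w0 Hp.
  (* From B (X k) = (B (X k) - B p) + B p and |X k - p|^2 <= 2 (M + |p|^2). *)
  set (MB := 2 * (L * L * (2 * (M + hinner p p)) + hinner (B p) (B p))).
  assert (bdB : forall k, hinner (B (X k)) (B (X k)) <= MB).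
  { intros k. pose proof (lipschitz_sq lipB (X k) p) as Lk.
    pose proof (inner_sub_sq_le (X k) p) as Sk. specialize (bd k).
    pose proof (Rle_0_sqr L) as L2. unfold Rsqr in L2.
    pose proof (inner_add_sq_le (hsub (B (X k)) (B p)) (B p)) as Ak.
    assert (E : hinner (B (X k)) (B (X k)) =
      hinner (hadd (hsub (B (X k)) (B p)) (B p)) (hadd (hsub (B (X k)) (B p)) (B p))).
    { clear. inner_expand. lra. }
    rewrite E. unfold MB.
    assert (L * L * hinner (hsub (X k) p) (hsub (X k) p) <= L * L * (2 * (M + hinner p p))).
    { apply Rmult_le_compat_l; lra. }
    lra. }
  destruct (weak_ulim_exists U HU H (fun k => B (X k)) MB bdB) as [q Hq].
  destruct (ulim_exists U HU (fun k => hinner (X k) (B (X k))) (M + MB)) as [c Hc].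
  { intros k. pose proof (inner_young (X k) (B (X k))).
    pose proof (inner_young_neg (X k) (B (X k))).
    pose proof (hinner_ge0 H (X k)). pose proof (hinner_ge0 H (B (X k))).
    specialize (bd k). specialize (bdB k). apply Rabs_le. lra. }
  assert (lims : forall y v, ulim U
    (fun k => hinner (X k) (B (X k)) - hinner (B (X k)) y - hinner (X k) v)
    (c - hinner q y - hinner p v)).
  { intros y v. apply ulim_sub; auto. apply ulim_sub; auto. }
  assert (ineqB : forall y, 0 <= hinner (hsub p y) (hsub q (B y)) + (c - hinner p q)).
  { intros y.
    pose proof (ulim_add U HU _ _ _ _ (lims y (B y))
      (ulim_const U HU (hinner y (B y)))) as W.
    replace (hinner (hsub p y) (hsub q (B y)) + (c - hinner p q))
      with (c - hinner q y - hinner p (B y) + hinner y (B y))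
      by (clear; inner_expand; lra).
    refine (ulim_le U HU _ _ _ _ _ (ulim_const U HU 0) W).
    intros k. simpl. pose proof (monoB (X k) y) as mk.
    clear - mk. inner_expand. lra. }
  assert (ineqA : forall y v, A y v ->
    c - hinner p q <= hinner (hsub p y) (hsub (hopp q) v)).
  { intros y v Ayv.
    (* Writing a k = w k - B (X k), the null sequence [w] drops out against the bounded X k - y and
       leaves the expression in [lims]. *)
    set (w := fun k => hadd (a k) (B (X k))).
    assert (bdy : forall k, hinner (hsub (X k) y) (hsub (X k) y) <= 2 * (M + hinner y y)).
    { intros k. pose proof (inner_sub_sq_le (X k) y). specialize (bd k). lra. }
    pose proof (ulim_cv U HU _ _ (inner_cv0 _ w _ bdy w0)) as Wz.
    pose proof (ulim_sub U HU _ _ _ _ Wz (lims y (hopp v))) as W.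
    assert (- hinner y v <= 0 - (c - hinner q y - hinner p (hopp v))) as G.
    { refine (ulim_le U HU _ _ _ _ _ (ulim_const U HU (- hinner y v)) W).
      intros k. simpl. pose proof (proj1 maxA _ _ _ _ (HA k) Ayv) as mk.
      unfold w. clear - mk. inner_expand. lra. }
    clear - G. inner_expand. lra. }
  assert (d0 : 0 <= c - hinner p q).
  { pose proof (ineqB p) as D. clear - D. inner_expand. lra. }
  assert (Apq : A p (hopp q)).
  { apply maximally_monotone_mem; [easy|]. intros y v Ayv.
    pose proof (ineqA y v Ayv). lra. }
  assert (d1 : c - hinner p q = 0).
  { pose proof (ineqA p _ Apq) as D. clear - D d0. inner_expand. lra. }
  assert (qB : q = B p).
  { apply monotone_lipschitz_mem. intros y. pose proof (ineqB y). lra. }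
  exists (hopp q). split; [easy|]. rewrite <- qB, haddC. apply haddN.
Qed.

(** * Lyapunov estimates and convergence of the iteration *)

Context (L_gt0 : 0 < L) (eps : R) (eps_gt0 : 0 < eps).

(** Young's inequality for L u and B x - B y gives both squares the factor L^2; one L cancels, the
    other is absorbed in l L. *)
Lemma lipschitz_cross_le l u x y :
  0 <= l -> l * L <= 1 / 2 - eps ->
  2 * l * hinner u (hsub (B x) (B y)) <=
  (1 / 2 - eps) * (hinner u u + hinner (hsub x y) (hsub x y)).
Proof.
  intros l0 lL.
  pose proof (lipschitz_sq lipB x y) as Lk.
  pose proof (inner_young (hscal L u) (hsub (B x) (B y))) as Yg.
  rewrite !hinnerZl, innerZr in Yg.
  pose proof (hinner_ge0 H u). pose proof (hinner_ge0 H (hsub x y)).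
  set (S := hinner u u + hinner (hsub x y) (hsub x y)).
  assert (2 * hinner u (hsub (B x) (B y)) <= L * S).
  { apply Rmult_le_reg_l with L; [easy|]. unfold S. lra. }
  apply Rle_trans with (l * L * S); [nra|].
  apply Rmult_le_compat_r; [unfold S; lra|easy].
Qed.

(** [x] and [y] stand for x_(k-1) and x_k, [l] for lam_(k-1). *)
Definition energy l x y z : R :=
  hinner (hsub y z) (hsub y z) + 2 * l * hinner (hsub y z) (hsub (B x) (B y))
  + 1 / 2 * hinner (hsub y x) (hsub y x).

(** The cross term costs at most 1/2 - eps of each square, and |y - x|^2 already has weight 1/2. *)
Lemma energy_ge l x y z :
  0 <= l -> l * L <= 1 / 2 - eps ->
  1 / 2 * hinner (hsub y z) (hsub y z) <= energy l x y z.
Proof.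
  intros l0 lL. unfold energy.
  pose proof (lipschitz_cross_le l (hsub y z) y x l0 lL) as C.
  assert (E : hinner (hsub y z) (hsub (B x) (B y)) =
    - hinner (hsub y z) (hsub (B y) (B x))) by (clear; inner_expand; lra).
  rewrite E. pose proof (hinner_ge0 H (hsub y z)).
  pose proof (hinner_ge0 H (hsub y x)). nra.
Qed.

(** Monotonicity at (x', z) gives <x' - z, a + B z> >= 0, and [E] eliminates l1 a. In the term with
    l0, split x' - z = (y - z) + (x' - y): the first part belongs to the old energy, the second is
    bounded by [lipschitz_cross_le]. *)
Lemma energy_step l0 l1 x y x' a z :
  monotone_op A -> zero_of_sum A B z -> A x' a ->
  0 <= l0 -> l0 * L <= 1 / 2 - eps -> 0 <= l1 ->
  hsub (hsub y (hscal l1 (B y))) (hscal l0 (hsub (B y) (B x)))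
    = hadd x' (hscal l1 a) ->
  energy l1 y x' z + eps * hinner (hsub x' y) (hsub x' y) <= energy l0 x y z.
Proof.
  intros monoA [b [Azb Eb]] Axa l00 l0L l10 E.
  assert (mA : 0 <= hinner (hsub x' z) (hadd a (B z))).
  { pose proof (monoA _ _ _ _ Axa Azb) as mk.
    assert (Eb' : hinner (hsub x' z) (hadd b (B z)) = 0) by (rewrite Eb; apply inner0r).
    clear - mk Eb'. inner_expand. lra. }
  pose proof (monoB x' z) as mB.
  assert (Ei : hinner (hsub x' z) (hscal l1 a) = hinner (hsub x' z)
    (hsub (hsub (hsub y (hscal l1 (B y))) (hscal l0 (hsub (B y) (B x)))) x')).
  { rewrite E. clear. inner_expand. lra. }
  pose proof (lipschitz_cross_le l0 (hsub x' y) x y l00 l0L) as C.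
  pose proof (hinner_ge0 H (hsub y x)) as D0.
  assert (mA' : 0 <= hinner (hsub x' z) (hscal l1 a)
    + l1 * hinner (hsub x' z) (B z)).
  { rewrite innerZr. rewrite innerDr in mA. nra. }
  assert (mB' : 0 <= l1 * hinner (hsub x' z) (hsub (B x') (B z))) by nra.
  assert (D0' : 0 <= eps * hinner (hsub y x) (hsub y x)) by nra.
  rewrite Ei in mA'. unfold energy.
  clear - mA' mB' C D0'. inner_expand. lra.
Qed.

(** By [E], l1 (a + B x') = l1 (B x' - B y) - l0 (B y - B x) - (x' - y); two uses of |u - v|^2 <= 2
    (|u|^2 + |v|^2) give the weights 3 = 4/4 + 2 and 1 = 4/4. *)
Lemma residual_le l0 l1 x y x' a :
  l0 * l0 * (L * L) <= 1 / 4 -> l1 * l1 * (L * L) <= 1 / 4 ->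
  hsub (hsub y (hscal l1 (B y))) (hscal l0 (hsub (B y) (B x)))
    = hadd x' (hscal l1 a) ->
  l1 * l1 * hinner (hadd a (B x')) (hadd a (B x')) <=
  3 * hinner (hsub x' y) (hsub x' y) + hinner (hsub y x) (hsub y x).
Proof.
  intros l0L l1L E.
  set (b1 := hsub (B x') (B y)). set (b0 := hsub (B y) (B x)).
  assert (Ew : hscal l1 (hadd a (B x')) =
    hsub (hsub (hscal l1 b1) (hscal l0 b0)) (hsub x' y)).
  { apply inner_ext. intros t.
    assert (Et := f_equal (fun h => hinner h t) E). simpl in Et.
    unfold b1, b0. clear - Et. inner_expand. lra. }
  assert (Es := f_equal (fun h => hinner h h) Ew). simpl in Es.
  rewrite hinnerZl, innerZr in Es.
  pose proof (inner_sub_sq_le (hsub (hscal l1 b1) (hscal l0 b0)) (hsub x' y)) as S1.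
  pose proof (inner_sub_sq_le (hscal l1 b1) (hscal l0 b0)) as S2.
  rewrite !hinnerZl, !innerZr in S2.
  pose proof (lipschitz_sq lipB x' y) as Lb1. fold b1 in Lb1.
  pose proof (lipschitz_sq lipB y x) as Lb0. fold b0 in Lb0.
  pose proof (hinner_ge0 H (hsub x' y)). pose proof (hinner_ge0 H (hsub y x)).
  assert (l1 * l1 * hinner b1 b1 <= 1 / 4 * hinner (hsub x' y) (hsub x' y)).
  { pose proof (Rle_0_sqr l1) as q1. unfold Rsqr in q1. nra. }
  assert (l0 * l0 * hinner b0 b0 <= 1 / 4 * hinner (hsub y x) (hsub y x)).
  { pose proof (Rle_0_sqr l0) as q0. unfold Rsqr in q0. nra. }
  lra.
Qed.

(** Indices are shifted by one, [y 0] being x_(-1) and [l 0] being lam_(-1), so that no step is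
    special. *)
Theorem forward_reflected_backward_cv (l : nat -> R) (y : nat -> H) :
  maximally_monotone A -> (exists z, zero_of_sum A B z) ->
  (forall k, eps <= l k <= (1 - 2 * eps) / (2 * L)) ->
  (forall k, resolvent_graph A (l (S k))
     (hsub (hsub (y (S k)) (hscal (l (S k)) (B (y (S k)))))
           (hscal (l k) (hsub (B (y (S k))) (B (y k)))))
     (y (S (S k)))) ->
  exists p, zero_of_sum A B p /\ weakly_converges (fun k => y (S k)) p.
Proof.
  intros maxA [z0 Hz0] Hl step.
  assert (lL : forall k, l k * L <= 1 / 2 - eps).
  { intros k. destruct (Hl k) as [_ le].
    apply Rmult_le_compat_r with (r := L) in le; [|lra].
    replace ((1 - 2 * eps) / (2 * L) * L) with (1 / 2 - eps) in le by (field; lra).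
    easy. }
  assert (l0 : forall k, 0 <= l k) by (intros k; specialize (Hl k); lra).
  assert (lL2 : forall k, l k * l k * (L * L) <= 1 / 4).
  { intros k. specialize (lL k). specialize (l0 k).
    assert (0 <= l k * L) by nra. nra. }
  set (a := fun k => proj1_sig (constructive_indefinite_description _ (step k))).
  assert (Ha : forall k, A (y (S (S k))) (a k)).
  { intros k. unfold a.
    exact (proj1 (proj2_sig (constructive_indefinite_description _ (step k)))). }
  assert (Ea : forall k, hsub (hsub (y (S k)) (hscal (l (S k)) (B (y (S k)))))
           (hscal (l k) (hsub (B (y (S k))) (B (y k))))
    = hadd (y (S (S k))) (hscal (l (S k)) (a k))).
  { intros k. unfold a.
    exact (proj2 (proj2_sig (constructive_indefinite_description _ (step k)))). }
  clearbody a.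
  set (D := fun k => hinner (hsub (y (S k)) (y k)) (hsub (y (S k)) (y k))).
  set (Phi := fun z k => energy (l k) (y k) (y (S k)) z).
  assert (D0 : forall k, 0 <= D k) by (intros; apply hinner_ge0).
  assert (dec : forall z k, zero_of_sum A B z -> Phi z (S k) + eps * D (S k) <= Phi z k).
  { intros z k Hz. unfold Phi, D.
    apply energy_step with (a := a k); auto. apply maxA. }
  assert (lower : forall z k,
    1 / 2 * hinner (hsub (y (S k)) z) (hsub (y (S k)) z) <= Phi z k).
  { intros z k. apply energy_ge; auto. }
  assert (Phi_cv : forall z, zero_of_sum A B z -> exists e, Un_cv (Phi z) e).
  { intros z Hz. destruct (Un_cv_crit (fun k => - Phi z k)) as [e He].
    - intros k. specialize (dec z k Hz). specialize (D0 (S k)). nra.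
    - exists 0. intros t [k ->]. specialize (lower z k).
      pose proof (hinner_ge0 H (hsub (y (S k)) z)). lra.
    - exists (- e). apply Un_cv_ext with (fun k => - - Phi z k).
      + intros; apply Ropp_involutive.
      + now apply CV_opp. }
  assert (D_cv : Un_cv D 0).
  { apply Un_cv_of_succ. destruct (Phi_cv z0 Hz0) as [e He].
    (* The decrease bounds eps D (k+1) by consecutive differences of a convergent sequence. *)
    apply Un_cv_squeeze0 with (fun k => / eps * (Phi z0 k - Phi z0 (S k))).
    - intros k. split; [apply D0|]. specialize (dec z0 k Hz0).
      apply Rmult_le_reg_l with eps; [easy|].
      rewrite <- Rmult_assoc, Rinv_r by lra. lra.
    - replace 0 with (/ eps * (e - e)) by ring.
      apply CV_mult; [apply Un_cv_const|].
      apply CV_minus; [easy|now apply Un_cv_succ]. }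
  assert (Phi_le : forall z k, zero_of_sum A B z -> Phi z k <= Phi z O).
  { intros z k Hz. induction k as [|k IH]; [lra|].
    specialize (dec z k Hz). specialize (D0 (S k)). nra. }
  assert (bdz : forall z k, zero_of_sum A B z ->
    hinner (hsub (y (S k)) z) (hsub (y (S k)) z) <= 2 * Phi z O).
  { intros z k Hz. specialize (Phi_le z k Hz). specialize (lower z k). lra. }
  set (M := 2 * (2 * Phi z0 O + hinner z0 z0)).
  assert (bd : forall k, hinner (y (S k)) (y (S k)) <= M).
  { intros k. specialize (bdz z0 k Hz0). unfold M.
    pose proof (inner_add_sq_le (hsub (y (S k)) z0) z0) as S1.
    assert (E : hinner (y (S k)) (y (S k)) =
      hinner (hadd (hsub (y (S k)) z0) z0) (hadd (hsub (y (S k)) z0) z0)).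
    { clear. inner_expand. lra. }
    lra. }
  apply opial with (M := M); [easy| |].
  - intros z Hz. destruct (Phi_cv z Hz) as [e He]. exists e.
    (* Putting the step size into [w] makes the cross term of the energy <y (k+1) - z, w k> with |w
       k|^2 <= D k, although [l] itself may not converge. *)
    set (w := fun k => hscal (2 * l k) (hsub (B (y k)) (B (y (S k))))).
    assert (w_cv : Un_cv (fun k => hinner (w k) (w k)) 0).
    { apply Un_cv_squeeze0 with D; [|easy]. intros k. split; [apply hinner_ge0|].
      unfold w, D. rewrite hinnerZl, innerZr.
      pose proof (lipschitz_sq lipB (y k) (y (S k))) as Lk.
      pose proof (Rle_0_sqr (l k)) as q. unfold Rsqr in q.
      specialize (lL2 k). specialize (D0 k). unfold D in D0.
      assert (E : hinner (hsub (y k) (y (S k))) (hsub (y k) (y (S k))) =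
        hinner (hsub (y (S k)) (y k)) (hsub (y (S k)) (y k)))
        by (clear; inner_expand; lra).
      rewrite E in Lk. nra. }
    pose proof (inner_cv0 (fun k => hsub (y (S k)) z) w _
      (fun k => bdz z k Hz) w_cv) as cross.
    apply Un_cv_ext with (fun k => Phi z k - hinner (hsub (y (S k)) z) (w k)
      - 1 / 2 * D k).
    + intros k. unfold Phi, energy, w, D. rewrite innerZr. ring.
    + replace e with (e - 0 - 1 / 2 * 0) by ring.
      apply CV_minus; [now apply CV_minus|].
      apply CV_mult; [apply Un_cv_const|easy].
  - intros U p HU Hp.
    apply zero_of_sum_weak_limit with (U := U) (M := M) (a := a)
      (X := fun k => y (S (S k))); auto.
    (* The factor 1 / eps^2 comes from l >= eps in the residual bound. *)
    + apply Un_cv_squeeze0 with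
        (fun k => / (eps * eps) * (3 * D (S k) + D k)).
      * intros k. split; [apply hinner_ge0|].
        pose proof (residual_le _ _ _ _ _ _ (lL2 k) (lL2 (S k)) (Ea k)) as Rk.
        set (wk := hinner (hadd (a k) _) _) in *.
        assert (0 <= wk) by apply hinner_ge0.
        destruct (Hl (S k)) as [el _].
        apply Rmult_le_reg_l with (eps * eps); [nra|].
        rewrite <- Rmult_assoc, Rinv_r by nra. rewrite Rmult_1_l.
        apply Rle_trans with (l (S k) * l (S k) * wk); [|exact Rk].
        apply Rmult_le_compat_r; [easy|]. nra.
      * replace 0 with (/ (eps * eps) * (3 * 0 + 0)) by ring.
        apply CV_mult; [apply Un_cv_const|]. apply CV_plus; [|easy].
        apply CV_mult; [apply Un_cv_const|]. now apply Un_cv_succ.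
    + intros v.
      (* Limits along [U] are not shift invariant; the shifted iterates share the weak limit [p]
         because successive differences vanish. *)
      pose proof (inner_cv0 (fun _ => v) (fun k => hsub (y (S (S k))) (y (S k)))
        (hinner v v) (fun _ => Rle_refl _) (Un_cv_succ _ _ D_cv)) as W.
      apply ulim_ext with (fun k => hinner (y (S k)) v
        + hinner v (hsub (y (S (S k))) (y (S k)))); [easy| |].
      * intros k. clear. inner_expand. lra.
      * replace (hinner p v) with (hinner p v + 0) by ring.
        apply ulim_add; auto. now apply ulim_cv.
Qed.

End Operators.

(* Indexing: [lam_m1] = λ_{-1}, [lam k] = λ_k (k ≥ 0); [x_m1] = x_{-1}, [x k] = x_k. *)
Theorem theorem2p5 (H : HilbertSpace) (A : setop H) (B : H -> H) (L eps : R)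
  (lam_m1 : R) (lam : nat -> R) (x_m1 : H) (x : nat -> H) :
  maximally_monotone A ->
  monotone_fun B ->
  0 < L ->
  lipschitz L B ->
  (exists z, zero_of_sum A B z) ->
  0 < eps ->
  (eps <= lam_m1 <= (1 - 2 * eps) / (2 * L)) ->
  (forall k, eps <= lam k <= (1 - 2 * eps) / (2 * L)) ->
  (forall k : nat,
     let lam_prev := match k with O => lam_m1 | S j => lam j end in
     let x_prev := match k with O => x_m1 | S j => x j end in
     resolvent_graph A (lam k)
       (hsub (hsub (x k) (hscal (lam k) (B (x k))))
             (hscal lam_prev (hsub (B (x k)) (B x_prev))))
       (x (S k))) ->
  exists p, zero_of_sum A B p /\ weakly_converges x p.
Proof.
  intros maxA monoB L0 lipB zer eps0 Hm1 Hlam step.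
  apply (forward_reflected_backward_cv A B L monoB lipB L0 eps eps0
    (fun k => match k with O => lam_m1 | S j => lam j end)
    (fun k => match k with O => x_m1 | S j => x j end)); auto.
  intros [|k]; auto.
Qed.
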